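(* Any CONGEST algorithm (possibly randomized, succeeding with probability at least $2/3$) that solves Replacement Paths or Second Simple Shortest Path in directed unweighted $n$-vertex graphs of undirected diameter $D$ requires $\Omega\!\left(\frac{\sqrt{n}}{\log n}+D\right)$ rounds in the worst case, even when the given shortest path $P_{st}$ has a constant number of edges (in fact a single edge). The same lower bound holds for any algorithm computing an $\alpha$-approximation of RPaths or 2-SiSP, for any constant $\alpha>1$.
   Context: CONGEST model: the communication network is the graph $G=(V,E)$, $n=|V|$; each node has a unique identifier in $\{0,\dots,n-1\}$, knows its own and its neighbours' identifiers and its incident edges; computation proceeds in synchronous rounds in which each node may send a message of $O(\log n)$ bits to each neighbour; local computation is free; communication links are bidirectional even when $G$ is directed. The undirected diameter $D$ is the diameter of the underlying undirected unweighted graph of $G$. Replacement Paths (RPaths): given $G$, $s,t$, and a shortest $s$-$t$ path $P_{st}$, for each edge $e\in P_{st}$ some vertex must compute the weight of a shortest simple $s$-$t$ path $P_e$ avoiding $e$, and every vertex on $P_e$ must know its successor on $P_e$. Second Simple Shortest Path (2-SiSP): some vertex must compute the weight of a minimum-weight simple $s$-$t$ path not containing at least one edge of $P_{st}$, and each vertex on it must know its successor. An $\alpha$-approximation outputs, for each required path, a weight between the optimum and $\alpha$ times the optimum (with infinite weight when no such path exists).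
   Formalization: The bound is stated for undirected diameter D with k·log n ≤ D ≤ n/k for some constant k; without a range it fails, e.g. for D = n−1 the network is a path, every replacement weight is infinite and no rounds are needed. *)

(* Defs.v *)
From Stdlib Require Import Reals.
From mathcomp Require Import all_boot.

Set Implicit Arguments.
Unset Strict Implicit.
Unset Printing Implicit Defensive.

(* Graphs.  A directed unweighted simple graph on the vertex set 'I_n *)
(* (identifiers 0..n-1) is an irreflexive relation E : rel 'I_n.      *)

Definition ugraph (n : nat) (E : rel 'I_n) : rel 'I_n :=
  fun u v => E u v || E v u.

Definition ureach_within (n : nat) (E : rel 'I_n) (u v : 'I_n) (k : nat) : Prop :=
  exists p : seq 'I_n, [/\ path (ugraph E) u p, last u p = v & size p <= k].

Definition udiam (n : nat) (E : rel 'I_n) (D : nat) : Prop :=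
  (forall u v, ureach_within E u v D) /\
  (D = 0 \/ exists u v, ~ ureach_within E u v D.-1).

Definition simple_st_path (n : nat) (E : rel 'I_n) (s t : 'I_n) (p : seq 'I_n) : bool :=
  [&& path E s p, last s p == t & uniq (s :: p)].

Definition path_edges (n : nat) (s : 'I_n) (p : seq 'I_n) : seq ('I_n * 'I_n) :=
  zip (s :: p) p.

(* weights: None = infinity, Some k = k *)
Definition wt := option nat.

Definition is_min_weight (n : nat) (E : rel 'I_n) (s t : 'I_n)
    (ok : seq 'I_n -> bool) (w : wt) : Prop :=
  match w with
  | None => forall p, simple_st_path E s t p -> ~~ ok p
  | Some k => (exists p, [/\ simple_st_path E s t p, ok p & size p = k]) /\
              (forall p, simple_st_path E s t p -> ok p -> k <= size p)
  end.

(* Problems.  The given shortest path is P_st = s :: P (P ends at t). *)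

Definition rp_ok (n : nat) (s : 'I_n) (P : seq 'I_n) (i : nat) (p : seq 'I_n) : bool :=
  nth (s, s) (path_edges s P) i \notin path_edges s p.

Definition sisp_ok (n : nat) (s : 'I_n) (P : seq 'I_n) (p : seq 'I_n) : bool :=
  ~~ all (fun e => e \in path_edges s p) (path_edges s P).

(* Output of a node: for each index i (edge i of P_st for RPaths, index 0
   for 2-SiSP) an optional claimed weight, and an optional successor. *)
Record NodeOut (n : nat) := mkNodeOut {
  claim : nat -> option wt;
  succ : nat -> option 'I_n
}.

Definition exact_solution (n : nat) (E : rel 'I_n) (s t : 'I_n) (m : nat)
    (ok : nat -> seq 'I_n -> bool) (outs : 'I_n -> NodeOut n) : Prop :=
  forall i, i < m ->
  exists w : wt, [/\ is_min_weight E s t (ok i) w,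
    (exists v, claim (outs v) i = Some w),
    (forall v w', claim (outs v) i = Some w' -> w' = w) &
    (forall k, w = Some k ->
       exists p, [/\ simple_st_path E s t p, ok i p, size p = k &
         forall j, j < size p ->
           succ (outs (nth s (s :: p) j)) i = Some (nth s p j)])].

Definition approx (alpha : R) (opt w : wt) : Prop :=
  match opt, w with
  | None, None => True
  | Some k, Some k' => k <= k' /\ Rle (INR k') (Rmult alpha (INR k))
  | _, _ => False
  end.

Definition approx_solution (alpha : R) (n : nat) (E : rel 'I_n) (s t : 'I_n)
    (m : nat) (ok : nat -> seq 'I_n -> bool) (outs : 'I_n -> NodeOut n) : Prop :=
  forall i, i < m ->
  exists w : wt, [/\ is_min_weight E s t (ok i) w,
    (exists v, claim (outs v) i <> None) &
    (forall v w', claim (outs v) i = Some w' -> approx alpha w w')].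

Inductive problem := RPaths | SiSP2 | RPathsApprox | SiSP2Approx.

Definition correct (pb : problem) (alpha : R) (n : nat) (E : rel 'I_n)
    (s : 'I_n) (P : seq 'I_n) (outs : 'I_n -> NodeOut n) : Prop :=
  let t := last s P in
  match pb with
  | RPaths => exact_solution E s t (size P) (rp_ok s P) outs
  | SiSP2 => exact_solution E s t 1 (fun _ => sisp_ok s P) outs
  | RPathsApprox => approx_solution alpha E s t (size P) (rp_ok s P) outs
  | SiSP2Approx => approx_solution alpha E s t 1 (fun _ => sisp_ok s P) outs
  end.

Definition msg (B : nat) := option (B.-tuple bool).  (* None = no message *)

Record Algo (n B L : nat) := mkAlgo {
  State : Type;
  (* initial state from: own id, s, P (P_st = s :: P), local edge info
     (for every id u: (edge v->u, edge u->v)), and the random tape *)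
  init : 'I_n -> 'I_n -> seq 'I_n -> ('I_n -> bool * bool) -> L.-tuple bool -> State;
  (* message sent to neighbour with the given id *)
  send : State -> 'I_n -> msg B;
  (* new state from old state and received messages (indexed by sender id) *)
  recv : State -> ('I_n -> msg B) -> State;
  out : State -> NodeOut n
}.

Definition tapes (n L : nat) := {ffun 'I_n -> L.-tuple bool}.

Fixpoint run (n B L : nat) (A : Algo n B L) (E : rel 'I_n) (s : 'I_n)
    (P : seq 'I_n) (om : tapes n L) (T : nat) : 'I_n -> State A :=
  match T with
  | 0 => fun v => @init _ _ _ A v s P (fun u => (E v u, E u v)) (om v)
  | T'.+1 =>
      let st := run A E s P om T' in
      fun v => @recv _ _ _ A (st v) (fun u => if ugraph E u v then @send _ _ _ A (st u) v else None)
  end.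

(* with probability >= 2/3 over the uniform random tapes, the outputs after
   T rounds are correct *)
Definition succeeds (n B L : nat) (A : Algo n B L) (pb : problem) (alpha : R)
    (E : rel 'I_n) (s : 'I_n) (P : seq 'I_n) (T : nat) : Prop :=
  exists S : {set tapes n L},
    (forall om, om \in S -> correct pb alpha E s P (fun v => @out _ _ _ A (run A E s P om T v))) /\
    2 * #|[set: tapes n L]| <= 3 * #|S|.

(* number of bits of an identifier, ~ log2 n *)
Definition lg (n : nat) : nat := (trunc_log 2 n).+1.

(* Main.v *)
Require Import Defs.
From Stdlib Require Import Reals.
From mathcomp Require Import all_boot.
From mathcomp Require Import all_order all_algebra zify ring.
From Stdlib Require Import Lra FunctionalExtensionality.

(* Lower bound by reduction from the inner product modulo 2 of an N-bit string
   x held by Alice and an N-bit string y held by Bob.  The network carries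
   4(N+1) parallel directed tracks, cut into p columns; only the edges inside
   column 0 depend on x and only those inside column p-1 depend on y, and apart
   from the edge s -> t a path from s to t exists iff the inner product is 1.
   Every column is attached to a hierarchy whose root starts a long tail; all
   these edges point towards the end of the tail, so they create no directed
   s-t path, while the tail makes the undirected diameter exactly D.
   After tau < p/2 rounds, the state of a vertex outside the last tau+1 columns
   depends on y only through the messages entering from few hierarchy nodes,
   and symmetrically for x.  Hence, for fixed random tapes, the inputs with a
   given record of those messages and of the claims form a rectangle.  By
   Lindsey's lemma 2^(N/2)/3 rectangles are needed to compute the inner product
   with probability 2/3.
   A binary tree as hierarchy, N ~ log^2(n) T and p = 2T+2, gives sqrt(n)/log n.
   A path parallel to the tracks needs no message across the cut, and N = 8
   then gives T >= D/16. *)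

Set Implicit Arguments.
Unset Strict Implicit.
Unset Printing Implicit Defensive.

(** * Discrepancy of the inner product *)

Section InnerProduct.
Import Order.TTheory GRing.Theory Num.Theory.
Local Open Scope ring_scope.

Variable N : nat.
Local Notation bits := {ffun 'I_N -> bool}.

Definition ip (x y : bits) : bool := \big[addb/false]_(i < N) (x i && y i).

Definition ip_sign (x y : bits) : int := (-1) ^+ ip x y.

Lemma ip_signE x y : ip_sign x y = \prod_(i < N) (-1) ^+ (x i && y i).
Proof.
rewrite /ip_sign /ip; apply: (big_morph (fun b : bool => (-1) ^+ b : int)) => //.
by move=> a b; rewrite signr_addb.
Qed.

(** The sum over [x] factors into a product over coordinates, and a coordinate where [y] and [y']
    differ contributes 1 - 1 = 0. *)
Lemma ip_sign_orthogonal (y y' : bits) :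
  \sum_x ip_sign x y * ip_sign x y' = if y == y' then 2 ^+ N else 0.
Proof.
pose F (i : 'I_N) (b : bool) : int := (-1) ^+ (b && y i) * (-1) ^+ (b && y' i).
transitivity (\sum_(x : bits) \prod_i F i (x i)).
  by apply: eq_bigr => x _; rewrite !ip_signE -big_split.
rewrite -(bigA_distr_bigA F) /=; case: eqP => [eqyy|neq].
  rewrite (eq_bigr (fun=> 2%:R)); first by rewrite prodr_const card_ord.
  by move=> i _; rewrite big_bool /F /= eqyy -signr_addb addbb !expr0 mulr1.
have [i neqi] : exists i, y i != y' i.
  apply/existsP; rewrite -negb_forall; apply/negP => /forallP eqy.
  by apply: neq; apply/ffunP => i; apply/eqP.
rewrite (bigD1 i) //= big_bool /F /=.
by case: (y i) (y' i) neqi => [] [] //= _; rewrite mul0r.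
Qed.

(** Cauchy-Schwarz against the constant 1. Expanding the sum of the squares of [#|A| * a i - S]
    avoids any division. *)
Lemma sqr_sum_le (I : finType) (A : {set I}) (a : I -> int) :
  (\sum_(i in A) a i) ^+ 2 <= #|A|%:R * \sum_(i in A) a i ^+ 2.
Proof.
set S := \sum_(i in A) a i; set Q := \sum_(i in A) a i ^+ 2.
have [/eqP A0|Apos] := posnP #|A|.
  by move: A0; rewrite /S /Q cards_eq0 => /eqP->; rewrite !big_set0 expr0n mulr0.
have: 0 <= \sum_(i in A) (#|A|%:R * a i - S) ^+ 2.
  by apply: sumr_ge0 => i _; apply: sqr_ge0.
rewrite (eq_bigr (fun i => (#|A|%:R ^+ 2 * a i ^+ 2 - (#|A|%:R * S) *+ 2 * a i)
   + S ^+ 2)); last first.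
  by move=> i _; ring.
rewrite big_split sumrB sumr_const -!mulr_sumr -/S -/Q /=.
set c : int := #|A|%:R.
have -> : c ^+ 2 * Q - (c * S) *+ 2 * S + S ^+ 2 *+ #|A| = c * (c * Q - S ^+ 2).
  by rewrite -[S ^+ 2 *+ _]mulr_natl -/c; ring.
by rewrite pmulr_rge0 ?subr_ge0 // ltr0n.
Qed.

(* Lindsey's lemma. *)
Lemma ip_sign_rectangle (A C : {set bits}) :
  (\sum_(x in A) \sum_(y in C) ip_sign x y) ^+ 2
    <= #|A|%:R * #|C|%:R * 2 ^+ N.
Proof.
apply: le_trans (sqr_sum_le _ _) _; rewrite -mulrA ler_wpM2l ?ler0n //.
(* Extending the sum from [A] to all [x] adds only squares and makes orthogonality applicable. *)
apply: (@le_trans _ _ (\sum_x (\sum_(y in C) ip_sign x y) ^+ 2)).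
  rewrite [leRHS](bigID (mem A)) /= lerDl.
  by apply: sumr_ge0 => x _; apply: sqr_ge0.
under eq_bigr do rewrite expr2 big_distrlr /=.
rewrite exchange_big /=; under eq_bigr do rewrite exchange_big /=.
rewrite (eq_bigr (fun=> 2 ^+ N)); first by rewrite sumr_const mulr_natl.
move=> y Cy; rewrite (bigD1 y) //= ip_sign_orthogonal eqxx big1 ?addr0 //.
by move=> y' /andP[_ neq]; rewrite ip_sign_orthogonal eq_sym (negbTE neq).
Qed.

Lemma card_bits : #|bits| = (2 ^ N)%N.
Proof. by rewrite card_ffun card_bool card_ord. Qed.

(** By [rect] each fibre of [tr] is a rectangle on which [d] is constant, so Lindsey's lemma bounds
    its share by the square root of 2^(3N). An even N makes this root the integer 2^(3M). *)
Lemma ip_correlation M (Z : finType) (tr : bits -> bits -> Z) (d : Z -> bool) :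
    N = M.*2 ->
    (forall x y x' y', tr x y = tr x' y' -> tr x y' = tr x y) ->
  \sum_x \sum_y (-1) ^+ d (tr x y) * ip_sign x y <= #|Z|%:R * 2 ^+ (3 * M).
Proof.
move=> NE rect.
have part x y : (-1) ^+ d (tr x y) * ip_sign x y
    = \sum_z (if tr x y == z then (-1) ^+ d z * ip_sign x y else 0).
  by rewrite -big_mkcond /= (big_pred1 (tr x y)) // => z; rewrite /= eq_sym.
under eq_bigr do under eq_bigr do rewrite part.
under eq_bigr do rewrite exchange_big /=.
rewrite exchange_big /= mulr_natl -sumr_const.
apply: ler_sum => z _.
pose A := [set x | [exists y, tr x y == z]].
pose C := [set y | [exists x, tr x y == z]].
have trE x y : (tr x y == z) = (x \in A) && (y \in C).
  rewrite !inE; apply/idP/andP => [xyz|[/existsP[y1 /eqP xy1] /existsP[x1 /eqP x1y]]].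
    by split; apply/existsP; [exists y|exists x].
  by rewrite -xy1; apply/eqP/(rect _ _ x1); rewrite xy1.
have -> : \sum_x \sum_y (if tr x y == z then (-1) ^+ d z * ip_sign x y else 0)
    = (-1) ^+ d z * \sum_(x in A) \sum_(y in C) ip_sign x y.
  rewrite mulr_sumr [RHS]big_mkcond; apply: eq_bigr => x _.
  rewrite mulr_sumr; case xA: (x \in A).
    by rewrite [RHS]big_mkcond; apply: eq_bigr => y _; rewrite trE xA.
  by rewrite big1 // => y _; rewrite trE xA.
have := ip_sign_rectangle A C; set S := \sum_(x in A) _ => leS.
apply: le_trans (ler_norm _) _; rewrite normrM normr_sign mul1r.
rewrite -(@ler_pXn2r _ 2) ?nnegrE ?exprn_ge0 ?normr_ge0 // real_normK ?num_real //.
apply: le_trans leS _; rewrite -exprM mulnC mulnA.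
have -> : (2 * 3 * M = N + N + N)%N by rewrite NE; lia.
rewrite !exprD ler_wpM2r ?exprn_ge0 // -natrX -card_bits -!natrM ler_nat.
by apply: leq_mul; apply: max_card.
Qed.

End InnerProduct.

(** Double counting of the correct triples ([om], [x], [y]): success probability 2/3 on every input
    forces an average correlation of at least 2^(4M) / 3, while each fixed [om] allows at most
    [#|Z|] * 2^(3M). *)
Lemma ip_rectangles_lower_bound M (N := M.*2) (Om Z : finType)
    (tr : Om -> {ffun 'I_N -> bool} -> {ffun 'I_N -> bool} -> Z) (d : Z -> bool) :
    0 < #|Om| ->
    (forall om x y x' y', tr om x y = tr om x' y' -> tr om x y' = tr om x y) ->
    (forall x y, exists S : {set Om},
       (forall om, om \in S -> d (tr om x y) = ip x y) /\ 2 * #|Om| <= 3 * #|S|) ->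
  2 ^ M <= 3 * #|Z|.
Proof.
move=> Om0 rect corr.
pose X : finType := {ffun 'I_N -> bool}.
pose good om x y := d (tr om x y) == ip x y.
pose W := \sum_x \sum_y \sum_om good om x y.
have Wlb : 2 ^ (4 * M) * (2 * #|Om|) <= 3 * W.
  have -> : 2 ^ (4 * M) = #|X| * #|X|.
    by rewrite card_bits -expnD /N; congr (_ ^ _); lia.
  rewrite /W big_distrr /= -mulnA -sum_nat_const leq_sum // => x _.
  rewrite big_distrr /= -sum_nat_const leq_sum // => y _.
  have [S [Sgood Sbig]] := corr x y.
  apply: leq_trans Sbig _; rewrite leq_mul2l /= -sum1_card big_mkcond leq_sum // => om _.
  by case: ifP => // omS; rewrite /good Sgood ?eqxx.
have Wub : 2 * W <= #|Om| * (2 ^ (4 * M) + #|Z| * 2 ^ (3 * M)).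
  have -> : W = \sum_om \sum_x \sum_y good om x y.
    by rewrite /W [RHS]exchange_big; apply: eq_bigr => x _; rewrite exchange_big.
  rewrite big_distrr /= -sum_nat_const leq_sum // => om _.
  have corrE : (\sum_x \sum_y (-1) ^+ d (tr om x y) * ip_sign x y
      = (\sum_x \sum_y good om x y)%N%:R *+ 2 - (2 ^ (4 * M))%:R :> int)%R.
    transitivity (\sum_x \sum_y ((good om x y)%:R *+ 2 - 1 : int))%R.
      apply: eq_bigr => x _; apply: eq_bigr => y _.
      by rewrite /ip_sign /good; case: (d _) (ip _ _) => [] [].
    have -> : 2 ^ (4 * M) = 2 ^ N * 2 ^ N by rewrite -expnD /N; congr (_ ^ _); lia.
    transitivity (\sum_(x : X) ((\sum_y good om x y)%N%:R *+ 2 - (2 ^ N)%:R : int))%R.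
      apply: eq_bigr => x _; rewrite GRing.sumrB GRing.sumrMnl -GRing.natr_sum.
      by rewrite GRing.sumr_const card_bits.
    rewrite GRing.sumrB GRing.sumrMnl -GRing.natr_sum GRing.sumr_const card_bits.
    by rewrite GRing.natrM GRing.mulr_natr.
  have := ip_correlation d (erefl : N = M.*2) (rect om); rewrite corrE.
  rewrite -GRing.natrX -GRing.natrM; set G := \sum_x _.
  by rewrite Num.Theory.lerBlDr -GRing.mulrnA -GRing.natrD Num.Theory.ler_nat mulnC addnC.
have pM : 2 ^ (4 * M) = 2 ^ (3 * M) * 2 ^ M by rewrite -expnD; congr (_ ^ _); lia.
have p0 : 0 < 2 ^ (3 * M) by rewrite expn_gt0.
rewrite -(leq_pmul2l p0) -pM -(leq_pmul2l Om0).
move: Wlb Wub; set a := 2 ^ (4 * M); set c := 2 ^ (3 * M); nia.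
Qed.

(** * Executions across a moving cut *)

Definition claims_finite n (o : NodeOut n) : bool :=
  if claim o 0 is Some (Some _) then true else false.

Section MovingCut.

Variables (n B L : nat) (A : Algo n B L) (s : 'I_n) (P : seq 'I_n).
Variables (om : tapes n L) (T : nat).
Variables (X Y : Type) (E : X -> Y -> rel 'I_n).
Variables (zoneA zoneB : nat -> pred 'I_n) (K : finType).
Variable (wire : nat -> K -> 'I_n * 'I_n).

Hypothesis localA : forall x y y' v u, zoneA 0 v ->
  E x y v u = E x y' v u /\ E x y u v = E x y' u v.
Hypothesis localB : forall x x' y v u, zoneB 0 v ->
  E x y v u = E x' y v u /\ E x y u v = E x' y u v.
Hypothesis shrinkA : forall tau v, tau < T -> zoneA tau.+1 v -> zoneA tau v.
Hypothesis shrinkB : forall tau v, tau < T -> zoneB tau.+1 v -> zoneB tau v.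
Hypothesis inflowA : forall x y tau u v, tau < T -> zoneA tau.+1 v ->
  ugraph (E x y) u v -> zoneA tau u \/ exists k, wire tau k = (u, v).
Hypothesis inflowB : forall x y tau u v, tau < T -> zoneB tau.+1 v ->
  ugraph (E x y) u v -> zoneB tau u \/ exists k, wire tau k = (u, v).
Hypothesis cover : forall tau v, tau <= T -> zoneA tau v || zoneB tau v.

Local Notation state x y tau := (run A (E x y) s P om tau).

(* zoneA tau collects vertices whose state after tau rounds depends on y only
   through the transcript, and zoneB those for which this holds of x; a message
   that enters a zone from outside travels along a wire. *)
Definition transcript x y : {ffun 'I_T * K -> msg B} :=
  [ffun q : 'I_T * K => send (state x y q.1 (wire q.1 q.2).1) (wire q.1 q.2).2].

Definition finite_in (zone : nat -> pred 'I_n) x y :=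
  [exists v, zone T v && claims_finite (out (state x y T v))].

(** One bit per zone is added to the transcript, so that the view determines the answer while its
    range stays small. *)
Definition view x y := (transcript x y, finite_in zoneA x y, finite_in zoneB x y).

Lemma zoneA0 tau v : tau <= T -> zoneA tau v -> zoneA 0 v.
Proof. by elim: tau => // tau IH lt /(shrinkA lt); apply/IH/ltnW. Qed.

Lemma zoneB0 tau v : tau <= T -> zoneB tau v -> zoneB 0 v.
Proof. by elim: tau => // tau IH lt /(shrinkB lt); apply/IH/ltnW. Qed.

(** Induction on [tau]. A message entering zone A comes from zone A itself or along a wire. In the
    latter case a sender outside zone A lies in zone B, hence behaves as on (x', y'), and the equal
    transcripts identify its message with the one sent on (x, y). *)
Lemma crossed_states x y x' y' : transcript x y = transcript x' y' ->
  forall tau, tau <= T ->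
    (forall v, zoneA tau v -> state x y' tau v = state x y tau v) /\
    (forall v, zoneB tau v -> state x y' tau v = state x' y' tau v).
Proof.
move=> eqtr; elim=> [|tau IH] leT.
  split=> v zv /=; congr (init _ _ _ _ _); apply: functional_extensionality => u.
    by have [-> ->] := localA x y' y u zv.
  by have [-> ->] := localB x x' y' u zv.
have [IHA IHB] := IH (ltnW leT).
have wireE k : let: (u, v) := wire tau k in
    send (state x y tau u) v = send (state x' y' tau u) v.
  have := congr1 (fun f : {ffun _} => f (Ordinal leT, k)) eqtr.
  by rewrite !ffunE /=; case: (wire tau k).
split=> v zv /=.
  rewrite (IHA _ (shrinkA leT zv)); congr (recv _ _).
  apply: functional_extensionality => u.
  have -> : ugraph (E x y') u v = ugraph (E x y) u v.
    by have [e1 e2] := localA x y' y u (zoneA0 leT zv); rewrite /ugraph e1 e2.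
  case: ifP => // uv.
  have [zu|[k wk]] := inflowA leT zv uv; first by rewrite IHA.
  have [zu|zu] := orP (cover u (ltnW leT)); first by rewrite IHA.
  by rewrite IHB //; have := wireE k; rewrite wk.
rewrite (IHB _ (shrinkB leT zv)); congr (recv _ _).
apply: functional_extensionality => u.
have -> : ugraph (E x y') u v = ugraph (E x' y') u v.
  by have [e1 e2] := localB x x' y' u (zoneB0 leT zv); rewrite /ugraph e1 e2.
case: ifP => // uv.
have [zu|[k wk]] := inflowB leT zv uv; first by rewrite IHB.
have [zu|zu] := orP (cover u (ltnW leT)); last by rewrite IHB.
by rewrite IHA //; have := wireE k; rewrite wk.
Qed.

Lemma view_rectangle x y x' y' : view x y = view x' y' -> view x y' = view x y.
Proof.
case=> eqtr eqA eqB; have crossed := crossed_states eqtr.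
have -> : view x y' = (transcript x y', finite_in zoneA x y, finite_in zoneB x' y').
  have [cA cB] := crossed T (leqnn T).
  congr (_, _, _); apply: eq_existsb => v.
    by case zv: (zoneA T v); rewrite //= cA.
  by case zv: (zoneB T v); rewrite //= cB.
rewrite -eqB; congr (_, _, _); apply/ffunP => -[[tau ltT] k]; rewrite !ffunE /=.
have [cA cB] := crossed tau (ltnW ltT).
have [zu|zu] := orP (cover (wire tau k).1 (ltnW ltT)); first by rewrite cA.
rewrite cB //.
have := congr1 (fun f : {ffun _} => f (Ordinal ltT, k)) eqtr.
by rewrite !ffunE /= => ->.
Qed.

Lemma view_claims x y :
  (finite_in zoneA x y || finite_in zoneB x y)
  = [exists v, claims_finite (out (state x y T v))].
Proof.
apply/orP/existsP => [[]/existsP[v /andP[_ fv]]|[v fv]]; try by exists v.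
by case/orP: (cover v (leqnn T)) => zv; [left|right]; apply/existsP; exists v; rewrite zv.
Qed.

Lemma card_view :
  #|{: {ffun 'I_T * K -> msg B} * bool * bool}| = 4 * (2 ^ B).+1 ^ (T * #|K|).
Proof.
rewrite !card_prod card_ffun card_prod card_ord card_option card_tuple card_bool.
by rewrite -mulnA mulnC.
Qed.

End MovingCut.

(** * Reading the answer off the claimed weights *)

Section AnswerFromClaims.

Variables (n : nat) (alpha : R) (pb : problem) (E : rel 'I_n) (s t : 'I_n).
Variable outs : 'I_n -> NodeOut n.

(** For a single-edge P_st both versions of [ok] mean avoiding that edge. Approximation by any
    factor preserves finiteness of the weight, so all four problems reveal whether another path
    exists. *)
Lemma correct_claims_finite : correct pb alpha E s [:: t] outs ->
  [exists v, claims_finite (outs v)] <->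
  exists p, simple_st_path E s t p && ((s, t) \notin path_edges s p).
Proof.
have main (ok : nat -> seq 'I_n -> bool) : (forall p, ok 0 p = ((s, t) \notin path_edges s p)) ->
    (exists w, [/\ is_min_weight E s t (ok 0) w, (exists v, claim (outs v) 0 <> None) &
      forall v w', claim (outs v) 0 = Some w' -> isSome w = isSome w']) ->
    [exists v, claims_finite (outs v)] <->
      exists p, simple_st_path E s t p && ((s, t) \notin path_edges s p).
  move=> okE [w [minw [v0 some0] all_claims]]; split.
    case/existsP=> v; rewrite /claims_finite.
    case cv: (claim _ _) => [[k|]|] // _; have := all_claims _ _ cv.
    case: w minw {all_claims} => //= k' [[p [sp okp _]] _] _.
    by exists p; rewrite sp -okE.
  case=> p /andP[sp]; rewrite -okE => okp; apply/existsP; exists v0.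
  rewrite /claims_finite; case cv: (claim _ _) some0 => [[k|]|] // _.
  have := all_claims _ _ cv; case: w minw {all_claims} => //= minw _.
  by have := minw _ sp; rewrite okp.
have claims_of_exact m ok : 0 < m -> exact_solution E s t m ok outs ->
    exists w, [/\ is_min_weight E s t (ok 0) w, (exists v, claim (outs v) 0 <> None) &
      forall v w', claim (outs v) 0 = Some w' -> isSome w = isSome w'].
  move=> m0 /(_ 0 m0)[w [minw [v cv] all_claims _]]; exists w; split=> //.
    by exists v; rewrite cv.
  by move=> u w' /all_claims ->.
have claims_of_approx m ok : 0 < m -> approx_solution alpha E s t m ok outs ->
    exists w, [/\ is_min_weight E s t (ok 0) w, (exists v, claim (outs v) 0 <> None) &
      forall v w', claim (outs v) 0 = Some w' -> isSome w = isSome w'].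
  move=> m0 /(_ 0 m0)[w [minw cv all_claims]]; exists w; split=> //.
  by move=> u w' /all_claims; case: w {minw all_claims} w' => [?|] [?|].
have sisp p : sisp_ok s [:: t] p = ((s, t) \notin path_edges s p).
  by rewrite /sisp_ok /= andbT.
case: pb => /=.
- by move/(claims_of_exact 1 _ isT); apply: (main (rp_ok s [:: t])).
- by move/(claims_of_exact 1 _ isT); apply: (main (fun=> sisp_ok s [:: t])).
- by move/(claims_of_approx 1 _ isT); apply: (main (rp_ok s [:: t])).
- by move/(claims_of_approx 1 _ isT); apply: (main (fun=> sisp_ok s [:: t])).
Qed.

End AnswerFromClaims.

(** * Diameter of a network hanging from a path *)

Section Diameter.

Variables (n : nat) (E : rel 'I_n).

Lemma ureach_refl u k : ureach_within E u u k.
Proof. by exists [::]. Qed.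

Lemma ureach_weaken u v k k' : k <= k' -> ureach_within E u v k -> ureach_within E u v k'.
Proof. by move=> le [p [pp lp sp]]; exists p; split=> //; apply: leq_trans le. Qed.

Lemma ureach_trans u v w k k' :
  ureach_within E u v k -> ureach_within E v w k' -> ureach_within E u w (k + k').
Proof.
move=> [p [pp lp sp]] [q [qq lq sq]]; exists (p ++ q).
by rewrite cat_path last_cat size_cat pp lp leq_add.
Qed.

Lemma ureach_sym u v k : ureach_within E u v k -> ureach_within E v u k.
Proof.
move=> [p [pp lp sp]]; exists (rev (belast u p)); split.
- rewrite -lp rev_path; apply: sub_path pp => a b.
  by rewrite /ugraph orbC.
- by case: p {pp sp} lp => [|a p] //= <-; rewrite rev_cons last_rcons.
- by rewrite size_rev size_belast.
Qed.

Variables (D m : nat) (ht : 'I_n -> nat) (par : 'I_n -> 'I_n).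

Hypothesis ugraph_par : forall v, 0 < ht v -> ugraph E v (par v).
Hypothesis ht_par : forall v, 0 < ht v -> ht (par v) = (ht v).-1.
Hypothesis ht_lipschitz : forall u v, ugraph E u v -> ht v <= (ht u).+1.
Hypothesis tail_unique : forall u v, ht u = ht v -> ht u <= m -> u = v.
Hypothesis ht_le : forall v, ht v <= D.
Hypothesis long_tail : 2 * (D - m) <= D.
Hypothesis ht_max : exists v, ht v = D.

Lemma ureach_par u k : k <= ht u ->
  ureach_within E u (iter k par u) k /\ ht (iter k par u) = ht u - k.
Proof.
elim: k => [|k IH] lek; first by rewrite subn0; split=> //; apply: ureach_refl.
have [IHr IHh] := IH (ltnW lek).
have pos : 0 < ht (iter k par u) by rewrite IHh subn_gt0.
split; last by rewrite /= ht_par // IHh subnS.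
rewrite -[X in ureach_within _ _ _ X]addn1; apply: ureach_trans IHr _.
by exists [:: par (iter k par u)]; rewrite /= ugraph_par.
Qed.

Lemma ureach_descend u v : ht v <= m -> ht v <= ht u -> ureach_within E u v (ht u - ht v).
Proof.
move=> vm vu; have [r h] := ureach_par (leq_subr (ht v) (ht u)).
have eqv : iter (ht u - ht v) par u = v by apply: tail_unique; rewrite h subKn.
by rewrite eqv in r.
Qed.

Lemma ht_path u p : path (ugraph E) u p -> ht (last u p) <= ht u + size p.
Proof.
elim: p u => [|a p IH] u /=; first by rewrite addn0.
by move=> /andP[/ht_lipschitz le /IH]; lia.
Qed.

(** Two vertices above height [m] meet at the unique vertex of height [m], at total cost at most 2(D
    - m) <= D; otherwise descending from the higher one reaches the lower one. Heights change by at
    most 1 along an edge, so heights 0 and D are at distance D. *)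
Lemma udiam_hanging : m <= D -> udiam E D.
Proof.
move=> mD; split.
  move=> u v; wlog le : u v / ht v <= ht u.
    move=> H; case: (leqP (ht v) (ht u)) => [/H//|/ltnW/H].
    exact: ureach_sym.
  have uD := ht_le u.
  have [vm|mv] := leqP (ht v) m.
    by apply: ureach_weaken (ureach_descend vm le); lia.
  have [w wD] := ht_max.
  have [_ rh] := ureach_par (leq_subr m (ht w)).
  have rm : ht (iter (ht w - m) par w) = m by rewrite rh; lia.
  set r := iter _ _ _ in rm.
  have ur := @ureach_descend u r; have vr := @ureach_descend v r.
  rewrite rm in ur vr.
  have := ureach_trans (ur (leqnn _) _) (ureach_sym (vr (leqnn _) _)).
  by move=> H; apply: (ureach_weaken _ (H _ _)); have := ht_le v; lia.
have [w wD] := ht_max; case: (posnP D) => [->|D0]; [by left|right].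
have [r] := ureach_par (leqnn (ht w)); set z := iter _ _ _; rewrite subnn => z0.
exists z, w => -[p [pp lp sp]].
by have := ht_path pp; rewrite lp z0 wD; lia.
Qed.

End Diameter.

(** * Paths avoiding the edge from s to t *)

Lemma avoiding_pathE n (E : rel 'I_n) s t u p :
  path (fun a b => E a b && ((a, b) != (s, t))) u p =
  path E u p && ((s, t) \notin path_edges u p).
Proof.
elim: p u => [|a p IH] u //=.
rewrite IH /path_edges /= inE negb_or [(s, t) == _]eq_sym.
by rewrite -!andbA; congr (_ && _); rewrite andbCA.
Qed.

Lemma avoiding_path_connect n (E : rel 'I_n) s t :
  (exists p, simple_st_path E s t p && ((s, t) \notin path_edges s p)) <->
  connect (fun a b => E a b && ((a, b) != (s, t))) s t.
Proof.
split=> [[p /andP[/and3P[pE /eqP <- _] nin]]|/connectP[p pE tE]].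
  by apply/connectP; exists p => //; rewrite avoiding_pathE pE.
case/shortenP: pE tE => q qE uq _ tE; exists q.
move: qE; rewrite avoiding_pathE /simple_st_path uq => /andP[-> ->].
by rewrite eq_sym tE eqxx.
Qed.

(** * The network of an input pair *)

(* A forest whose leaf c is adjacent to column c of the network and whose roots
   are attached to the tail.  Nodes in nodesA tau are still independent of
   Bob's input after tau rounds, except through the messages sent by the nodes
   wire tau k to their parents. *)
Record hierarchy (p T : nat) (K : finType) := Hierarchy {
  node : finType;
  parent : node -> option node;
  leaf : 'I_p -> node;
  height : node -> nat;
  top : nat;
  nodesA : nat -> pred node;
  nodesB : nat -> pred node;
  rootA : bool;
  rootB : bool;
  wire : nat -> K -> node;
  height_parent : forall a,
    height a = if parent a is Some a' then (height a').+1 else 1;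
  height_leaf_step : forall c c' : 'I_p, c' = c.+1 :> nat ->
    height (leaf c) <= (height (leaf c')).+1 /\
    height (leaf c') <= (height (leaf c)).+1;
  height_le : forall a, height a <= top;
  height_top : exists c, height (leaf c) = top;
  root_cover : rootA || rootB;
  node_cover : forall tau a, tau <= T -> nodesA tau a || nodesB tau a;
  leafA : forall tau c, tau <= T -> nodesA tau (leaf c) = (c + tau + 2 <= p);
  leafB : forall tau c, tau <= T -> nodesB tau (leaf c) = (tau < c);
  shrinkA : forall tau a, tau < T -> nodesA tau.+1 a -> nodesA tau a;
  shrinkB : forall tau a, tau < T -> nodesB tau.+1 a -> nodesB tau a;
  parentA : forall tau a, tau < T -> nodesA tau.+1 a ->
    if parent a is Some a' then nodesA tau a' else rootA;
  parentB : forall tau a, tau < T -> nodesB tau.+1 a ->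
    if parent a is Some a' then nodesB tau a' else rootB;
  childA : forall tau a a', tau < T -> parent a = Some a' -> nodesA tau.+1 a' ->
    nodesA tau a \/ exists k, wire tau k = a;
  childB : forall tau a a', tau < T -> parent a = Some a' -> nodesB tau.+1 a' ->
    nodesB tau a \/ exists k, wire tau k = a;
  root_childA : forall tau a, tau <= T -> parent a = None -> rootA -> nodesA tau a;
  root_childB : forall tau a, tau <= T -> parent a = None -> rootB -> nodesB tau a
}.

Arguments leaf {p T K} _ _.
Arguments top {p T K} _.
Arguments nodesA {p T K} _ _ _.
Arguments nodesB {p T K} _ _ _.
Arguments rootA {p T K} _.
Arguments rootB {p T K} _.
Arguments wire {p T K} _ _ _.

Section Network.

Variables (p' T : nat).
Let p := p'.+2.
Variables (K : finType) (H : hierarchy p T K) (N m q' : nat).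
Let q := q'.+1.

Local Notation bits := {ffun 'I_N -> bool}.

(* A site (k, i, c, j) lies in column j; its track is directed towards higher
   columns when k is true and towards column 0 otherwise.  A walk from the
   source that returns to column 0 on the track (false, i, c) has computed the
   partial inner product c of the first i bits. *)
Definition site : finType := (bool * 'I_N.+1 * bool * 'I_p)%type.

Definition vertex : finType := (site + node H + 'I_q)%type.

(** The default value serves level N: there Alice's edge would have to lead to level N + 1, so none
    exists. *)
Definition bit (x : bits) (i : nat) : bool := if insub i is Some i' then x i' else false.

Definition source_site : site := (false, ord0, false, ord0).
Definition target_site : site := (false, ord_max, true, ord0).

Definition source : vertex := inl (inl source_site).
Definition target : vertex := inl (inl target_site).

Definition track_edge (u v : site) : bool :=
  let: (k, i, c, j) := u in let: (k', i', c', j') := v in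
  [&& k == k', i == i', c == c' & if k then j' == j.+1 :> nat else j == j'.+1 :> nat].

(** If bit [i] of x is 0, its product is 0 and the walk moves on to level [i.+1] at once; if it is
    1, the walk must travel to Bob's column, where bit [i] of y is added to [c]. *)
Definition alice_edge (x : bits) (u v : site) : bool :=
  let: (k, i, c, j) := u in let: (k', i', c', j') := v in
  [&& j == 0 :> nat, j' == 0 :> nat, ~~ k, c' == c &
    if bit x i then k' && (i' == i :> nat) else ~~ k' && (i' == i.+1 :> nat)].

Definition bob_edge (y : bits) (u v : site) : bool :=
  let: (k, i, c, j) := u in let: (k', i', c', j') := v in
  [&& j.+1 == p :> nat, j'.+1 == p :> nat, k, ~~ k', i' == i.+1 :> nat
    & c' == c (+) bit y i].

Definition site_edge x y (u v : site) : bool :=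
  [|| track_edge u v, alice_edge x u v | bob_edge y u v].

(* The pads 0, ..., m form a path, pad m being the root of the hierarchy and
   of the remaining pads. *)
Definition par (v : vertex) : vertex :=
  match v with
  | inl (inl (_, c)) => inl (inr (leaf H c))
  | inl (inr a) => if parent a is Some a' then inl (inr a') else inr (inord m)
  | inr i => inr (inord (minn i.-1 m))
  end.

Definition vheight (v : vertex) : nat :=
  match v with
  | inl (inl (_, c)) => m + (height (leaf H c)).+1
  | inl (inr a) => m + height a
  | inr i => minn i m.+1
  end.

(** The height condition removes the loop at pad 0, its own parent. Parent edges never lead to a
    site, so a walk leaving the sites cannot return. *)
Definition edge x y (u v : vertex) : bool :=
  match u, v with
  | inl (inl a), inl (inl b) =>
      site_edge x y a b || ((a, b) == (source_site, target_site))
  | _, _ => (v == par u) && (0 < vheight u)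
  end.

Definition zoneA tau (v : vertex) : bool :=
  match v with
  | inl (inl (_, c)) => c + tau + 2 <= p
  | inl (inr a) => nodesA H tau a
  | inr _ => rootA H
  end.

Definition zoneB tau (v : vertex) : bool :=
  match v with
  | inl (inl (_, c)) => tau < c
  | inl (inr a) => nodesB H tau a
  | inr _ => rootB H
  end.

Definition vwire tau (k : K) : vertex * vertex :=
  (inl (inr (wire H tau k)), par (inl (inr (wire H tau k)))).

Lemma height_gt0 (a : node H) : 0 < height a.
Proof. by rewrite height_parent; case: parent. Qed.

Lemma site_edge_column x y tr c tr' c' :
  site_edge x y (tr, c) (tr', c') -> [\/ c = c', c = c'.+1 :> nat | c' = c.+1 :> nat].
Proof.
case: tr tr' => [[k i] b] [[k' i'] b'] /or3P[/and4P[_ _ _]|/and5P[]|/and5P[]].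
- by case: k => /eqP; [constructor 3|constructor 2].
- by move=> /eqP c0 /eqP c'0 _ _ _; constructor 1; apply: ord_inj; rewrite c0 c'0.
- by move=> /eqP c0 /eqP c'0 _ _ _; constructor 1; apply: ord_inj; lia.
Qed.

Lemma edge_column x y tr c tr' c' :
  edge x y (inl (inl (tr, c))) (inl (inl (tr', c'))) ->
  [\/ c = c', c = c'.+1 :> nat | c' = c.+1 :> nat].
Proof.
by case/orP => [/site_edge_column//|/eqP[_ -> _ ->]]; constructor 1.
Qed.

Lemma vheight_unique u v : vheight u = vheight v -> vheight u <= m -> u = v.
Proof.
case: u v => [[[tr c]|a]|i] [[[tr' c']|a']|i'] /=;
  try have := height_gt0 a; try have := height_gt0 a'; try lia.
by move=> e le; congr inr; apply: ord_inj; lia.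
Qed.

Lemma vheight_le v : vheight v <= m + (top H).+1.
Proof.
case: v => [[[tr c]|a]|i] /=.
- by rewrite leq_add2l ltnS height_le.
- by rewrite leq_add2l (leq_trans (height_le a)).
- by rewrite (leq_trans (geq_minr _ _)) // addnS ltnS leq_addr.
Qed.

Lemma vheight_max : exists v, vheight v = m + (top H).+1.
Proof.
have [c hc] := height_top H.
by exists (inl (inl ((false, ord0, false), c))); rewrite /= hc.
Qed.

Lemma edge_localA x y y' v u : zoneA 0 v ->
  edge x y v u = edge x y' v u /\ edge x y u v = edge x y' u v.
Proof.
case: v u => [[[[[k i] c] j]|a]|i0] [[[[[k' i'] c'] j']|a']|i0'] //= zv.
have jp : (j.+1 == p) = false by apply/negbTE; lia.
by rewrite /site_edge /= jp /= !andbF.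
Qed.

Lemma edge_localB x x' y v u : zoneB 0 v ->
  edge x y v u = edge x' y v u /\ edge x y u v = edge x' y u v.
Proof.
case: v u => [[[[[k i] c] j]|a]|i0] [[[[[k' i'] c'] j']|a']|i0'] //= zv.
have jp : (j == 0 :> nat) = false by apply/negbTE; lia.
by rewrite /site_edge /= jp /= !andbF.
Qed.

Lemma zone_shrinkA tau v : tau < T -> zoneA tau.+1 v -> zoneA tau v.
Proof.
by case: v => [[[tr c]|a]|i] /= ltT; [lia|apply: shrinkA|].
Qed.

Lemma zone_shrinkB tau v : tau < T -> zoneB tau.+1 v -> zoneB tau v.
Proof.
by case: v => [[[tr c]|a]|i] /= ltT; [lia|apply: shrinkB|].
Qed.

Lemma adjacent_cases x y u v : edge x y u v || edge x y v u ->
  [\/ exists tr c tr' c', [/\ u = inl (inl (tr, c)), v = inl (inl (tr', c'))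
        & [\/ c = c', c = c'.+1 :> nat | c' = c.+1 :> nat]],
      v = par u | u = par v].
Proof.
have hanging a b : ~~ (if (a, b) is (inl (inl _), inl (inl _)) then true else false) ->
    edge x y a b -> b = par a.
  by case: a b => [[a|a]|a] [[b|b]|b] // _ /andP[/eqP].
have general : ~~ (if (u, v) is (inl (inl _), inl (inl _)) then true else false) ->
    edge x y u v || edge x y v u -> v = par u \/ u = par v.
  by case: u v hanging => [[a|a]|a] [[b|b]|b] hanging // _ /orP[/hanging|/hanging] ->; auto.
case: u v general => [[[tr c]|a]|i] [[[tr' c']|a']|i'] general uv;
  try by case: (general isT uv) => ->; [constructor 2|constructor 3].
constructor 1; exists tr, c, tr', c'; split=> //.
case/orP: uv => /edge_column //.
by case=> [->|e|e]; [constructor 1|constructor 3|constructor 2].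
Qed.

Lemma zone_inflowA x y tau u v : tau < T -> zoneA tau.+1 v ->
  edge x y u v || edge x y v u -> zoneA tau u \/ exists k, vwire tau k = (u, v).
Proof.
move=> ltT zv /adjacent_cases[[tr [c [tr' [c' [-> ve cc]]]]]|ve|->].
- by left; move: zv; rewrite ve /=; case: cc => [->|->|->]; lia.
- rewrite {}ve in zv *; case: u zv => [[[tr c]|a]|i] //=.
  + by rewrite leafA // => zv; left; lia.
  + case pa: (parent a) => [a'|] /= zv; last by left; apply: root_childA pa zv; apply: ltnW.
    have [?|[k wk]] := childA ltT pa zv; first by left.
    by right; exists k; rewrite /vwire wk /= pa.
  + by left.
- left; case: v zv => [[[tr c]|a]|i] //=.
  + by rewrite leafA ?(ltnW ltT) //; lia.
  + by move/(parentA ltT); case: parent.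
Qed.

Lemma zone_inflowB x y tau u v : tau < T -> zoneB tau.+1 v ->
  edge x y u v || edge x y v u -> zoneB tau u \/ exists k, vwire tau k = (u, v).
Proof.
move=> ltT zv /adjacent_cases[[tr [c [tr' [c' [-> ve cc]]]]]|ve|->].
- by left; move: zv; rewrite ve /=; case: cc => [->|->|->]; lia.
- rewrite {}ve in zv *; case: u zv => [[[tr c]|a]|i] //=.
  + by rewrite leafB // => zv; left; lia.
  + case pa: (parent a) => [a'|] /= zv; last by left; apply: root_childB pa zv; apply: ltnW.
    have [?|[k wk]] := childB ltT pa zv; first by left.
    by right; exists k; rewrite /vwire wk /= pa.
  + by left.
- left; case: v zv => [[[tr c]|a]|i] //=.
  + by rewrite leafB ?(ltnW ltT) //; lia.
  + by move/(parentB ltT); case: parent.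
Qed.

(** * Directed reachability computes the inner product *)

Section Reachability.

Variables x y : bits.

Definition avoiding : rel vertex :=
  fun u v => edge x y u v && ((u, v) != (source, target)).

Definition partial (i : nat) : bool := \big[addb/false]_(0 <= k < i) (bit x k && bit y k).

Lemma partialS i : partial i.+1 = partial i (+) (bit x i && bit y i).
Proof. by rewrite /partial big_nat_recr. Qed.

Lemma partial_ip : partial N = ip x y.
Proof.
rewrite /partial big_mkord; apply: eq_bigr => i _.
by rewrite /bit !valK.
Qed.

(** Invariant of walks from the source: [c] is the partial inner product of the level, and forward
    tracks are entered only where x has a 1. It may be vacuous off the sites, since no edge leads
    back. *)
Definition on_track (v : vertex) : bool :=
  if v is inl (inl (k, i, c, _)) then (c == partial i) && (k ==> bit x i) else true.

Lemma avoiding_on_track u v : avoiding u v -> on_track u -> on_track v.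
Proof.
case: v => [[[[[k' i'] c'] j']|a']|i0'] //.
case: u => [[[[[k i] c] j]|a]|i0] //; rewrite /avoiding /edge /par; last first.
  by case: (parent a) => [a'|] /andP[/andP[]].
rewrite /=.
case/andP=> /orP[|/eqP[-> -> -> -> -> -> -> ->]]; last by rewrite eqxx.
move=> e _ /andP[/eqP cE kx]; case/or3P: e.
- by case/and4P=> /eqP<- /eqP<- /eqP<- _; rewrite cE eqxx.
- case/and5P=> _ _ nk /eqP->; case: ifP => [xi /andP[-> /eqP->]|xi /andP[nk' /eqP->]].
    by rewrite cE eqxx xi.
  by rewrite (negbTE nk') partialS xi addbF cE eqxx.
- case/and5P=> _ _ k1 nk' /andP[/eqP-> /eqP->].
  by rewrite (negbTE nk') partialS; rewrite k1 /= in kx; rewrite kx cE eqxx.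
Qed.

(** Tracks and Alice's edges preserve [c], which differs at source and target, and Bob's edges start
    on forward tracks; so no site edge is the forbidden edge. *)
Lemma site_avoiding a b : site_edge x y a b -> avoiding (inl (inl a)) (inl (inl b)).
Proof.
move=> e; rewrite /avoiding /= e /=; apply/eqP => -[ea eb]; move: e.
rewrite {}ea {}eb => /or3P[/and4P[]//|/and5P[]//|/and5P[]//].
Qed.

Local Notation at_site k i c j := (inl (inl (k, i, c, j)) : vertex).

Lemma along_forward i c j : connect avoiding (at_site true i c ord0) (at_site true i c j).
Proof.
case: j => j; elim: j => [|j IH] jp; first by rewrite (_ : Ordinal jp = ord0) //; apply: ord_inj.
apply: connect_trans (IH (ltnW jp)) _; apply/connect1/site_avoiding.
by rewrite /site_edge /= !eqxx.
Qed.

Lemma along_backward i c j : connect avoiding (at_site false i c j) (at_site false i c ord0).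
Proof.
case: j => j; elim: j => [|j IH] jp; first by rewrite (_ : Ordinal jp = ord0) //; apply: ord_inj.
apply: connect_trans (IH (ltnW jp)); apply/connect1/site_avoiding.
by rewrite /site_edge /= !eqxx.
Qed.

Lemma connect_partial (i : 'I_N.+1) :
  connect avoiding source (at_site false i (partial i) ord0).
Proof.
case: i => i; elim: i => [|i IH] iN /=.
  by rewrite /partial big_geq // (_ : Ordinal iN = ord0) //; apply: ord_inj.
apply: connect_trans (IH (ltnW iN)) _ => /=; rewrite partialS.
case xi: (bit x i); last first.
  by apply/connect1/site_avoiding; rewrite /site_edge /= xi addbF !eqxx /= orbT.
apply: (@connect_trans _ _ (at_site true (Ordinal (ltnW iN)) (partial i) ord0)).
  by apply/connect1/site_avoiding; rewrite /site_edge /= xi !eqxx /= ?orbT.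
apply: connect_trans (along_forward _ _ ord_max) _.
apply: connect_trans (along_backward _ _ ord_max).
by apply/connect1/site_avoiding; rewrite /site_edge /= ?eqxx.
Qed.

Lemma reachable_ip : connect avoiding source target = ip x y.
Proof.
rewrite -partial_ip; apply/idP/idP => [/connectP[r rE tE]|ipT]; last first.
  by have := connect_partial ord_max; rewrite /= ipT.
have : on_track source by rewrite /= /partial big_geq.
have walk a : path avoiding a r -> on_track a -> on_track (last a r).
  elim: r a {rE tE} => [|b r IH] a //= /andP[ab /IH{}IH].
  by move/(avoiding_on_track ab).
by move/(walk _ rE); rewrite -tE /= andbT => /eqP.
Qed.

End Reachability.

(** A column outside zone A is among the last [tau] + 1 <= T + 1 of at least 2T + 2 columns, so its
    index exceeds T. *)
Lemma zone_cover tau v : 2 * T + 2 <= p -> tau <= T -> zoneA tau v || zoneB tau v.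
Proof.
case: v => [[[tr c]|a]|i]  /= cols leT; first by apply/orP; lia.
  exact: node_cover.
exact: root_cover.
Qed.

Hypothesis tail_fits : m < q.

Lemma pad_val i : i <= m -> (inord i : 'I_q) = i :> nat.
Proof. by move=> im; rewrite inordK // (leq_ltn_trans im). Qed.

Lemma vheight_par v : 0 < vheight v -> vheight (par v) = (vheight v).-1.
Proof.
case: v => [[[tr c]|a]|i] /=; first by rewrite addnS.
  move=> _; rewrite [height a]height_parent; case: parent => [a'|] /=; first by rewrite addnS.
  by rewrite pad_val // addn1 /=; apply/minn_idPl.
by move=> i0; rewrite pad_val ?geq_minr //; lia.
Qed.

Lemma edge_par x y v : 0 < vheight v -> edge x y v (par v).
Proof.
by case: v => [[[tr c]|a]|i] /= => [_|->|->]; rewrite ?eqxx //= addnS.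
Qed.

Lemma edge_height x y u v : edge x y u v ->
  vheight u <= (vheight v).+1 /\ vheight v <= (vheight u).+1.
Proof.
have up : (v == par u) && (0 < vheight u) ->
    vheight u <= (vheight v).+1 /\ vheight v <= (vheight u).+1.
  by case/andP=> /eqP-> /vheight_par->; lia.
case: u v up => [[[tr c]|a]|i] [[[tr' c']|a']|i'] // _ e.
have step := @height_leaf_step _ _ _ H.
case: (edge_column e) => [->|ec|ec] /=; first by lia.
  by have := step _ _ ec; lia.
by have := step _ _ ec; lia.
Qed.

Lemma edge_irrefl x y v : edge x y v v = false.
Proof.
case e: (edge x y v v) => //.
have up : (v == par v) && (0 < vheight v) -> False.
  by case/andP=> /eqP vp h0; have := vheight_par h0; rewrite -vp; lia.
case: v e up => [[[[[k i] c] j]|a]|i'] /= e up; try by case: (up e).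
case/orP: e => [/or3P[/and4P[_ _ _]|/and5P[_ _ nk _]|/and5P[_ _ k1 nk]]|].
- by case: ifP; lia.
- by rewrite (negbTE nk) /=; case: ifP => //; lia.
- by rewrite k1 in nk.
- by rewrite !xpair_eqE; case: c => //; rewrite ?andbF.
Qed.

End Network.

Lemma connect_homo (V W : finType) (e : rel V) (e' : rel W) (h : V -> W) a b :
  (forall u v, e u v -> e' (h u) (h v)) -> connect e a b -> connect e' (h a) (h b).
Proof.
move=> he /connectP[r rE ->]; elim: r a rE => [|c r IH] a //= /andP[/he ac /IH].
by apply: connect_trans; apply: connect1.
Qed.

(** * Communication bound for the renamed network *)

Section NetworkBound.

Variables (p' T : nat) (K : finType) (H : hierarchy p'.+2 T K) (M m q' n : nat).
Let N := M.*2.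
Hypothesis enough_columns : 2 * T + 2 <= p'.+2.
Hypothesis tail_fits : m < q'.+1.
Hypothesis card_network : #|vertex H N q'| = n.
Hypothesis long_tail : top H < m.

Definition name (v : vertex H N q') : 'I_n := cast_ord card_network (enum_rank v).
Definition role (i : 'I_n) : vertex H N q' := enum_val (cast_ord (esym card_network) i).

Lemma nameK : cancel name role.
Proof. by move=> v; rewrite /role /name cast_ordK enum_rankK. Qed.

Lemma roleK : cancel role name.
Proof. by move=> i; rewrite /role /name enum_valK cast_ordKV. Qed.

Definition network x y : rel 'I_n := fun u v => edge m x y (role u) (role v).

Lemma network_udiam x y : udiam (network x y) (m + (top H).+1).
Proof.
have hE v : 0 < vheight m (role v) -> ugraph (network x y) v (name (par m (role v))).
  by move=> h0; rewrite /ugraph /network nameK edge_par.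
apply: (@udiam_hanging _ _ _ m (fun v => vheight m (role v)) (fun v => name (par m (role v)))).
- exact: hE.
- by move=> v h0; rewrite nameK vheight_par.
- by move=> u v /orP[] /edge_height[].
- by move=> u v e le; apply: (can_inj roleK); apply: vheight_unique le.
- by move=> v; apply: vheight_le.
- by lia.
- by have [v vE] := vheight_max H N m q'; exists (name v); rewrite nameK.
- by lia.
Qed.

Lemma network_irreflexive x y : irreflexive (network x y).
Proof. by move=> v; apply: edge_irrefl. Qed.

Lemma network_answer x y :
  (exists r, simple_st_path (network x y) (name (source H N q')) (name (target H N q')) r
     && ((name (source H N q'), name (target H N q')) \notin
           path_edges (name (source H N q')) r))
  <-> ip x y.
Proof.
rewrite avoiding_path_connect -(reachable_ip H m q' x y); split=> c.
  rewrite -[source _ _ _]nameK -[target _ _ _]nameK.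
  apply: connect_homo c => u v /andP[uv neq]; rewrite /avoiding [edge _ _ _ _ _]uv /=.
  apply: contraNN neq => /eqP[<- <-].
  by rewrite !roleK.
apply: connect_homo c => u v /andP[uv neq].
by rewrite /network !nameK uv /= xpair_eqE !(can_eq nameK) -xpair_eqE.
Qed.

Lemma network_bound B L (A : Algo n B L) (alpha : R) (pb : problem) :
    (forall (E : rel 'I_n) (s t : 'I_n),
        irreflexive E -> udiam E (m + (top H).+1) -> s != t -> E s t ->
        succeeds A pb alpha E s [:: t] T) ->
  2 ^ M <= 12 * (2 ^ B).+1 ^ (T * #|K|).
Proof.
move=> succ_A.
set s := name (source H N q'); set t := name (target H N q').
have st : s != t by apply/eqP => /(can_inj nameK).
have succ_xy x y : succeeds A pb alpha (network x y) s [:: t] T.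
  apply: succ_A => //; first exact: network_irreflexive.
    exact: network_udiam.
  by rewrite /network !nameK /edge /= eqxx orbT.
pose zA tau v := zoneA tau (role v).
pose zB tau v := zoneB tau (role v).
pose wires tau k := (name (vwire H N m q' tau k).1, name (vwire H N m q' tau k).2).
pose tr (om : tapes n L) x y := view A s [:: t] om T network zA zB wires x y.
(* The factor 3 comes from averaging over the tapes, the factor 4 from the two claim bits of the
   view. *)
rewrite -[12]/(3 * 4) -mulnA -(card_view B T K).
have cover tau v : tau <= T -> zA tau v || zB tau v by apply: zone_cover.
apply: (@ip_rectangles_lower_bound M (tapes n L) _ tr (fun z => z.1.2 || z.2)).
- by apply/card_gt0P; exists [ffun=> nseq_tuple L false].
- move=> om x y x' y'; apply: view_rectangle => //.
  + by move=> ? ? ? ? ?; apply: edge_localA.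
  + by move=> ? ? ? ? ?; apply: edge_localB.
  + by move=> ? ?; apply: zone_shrinkA.
  + by move=> ? ?; apply: zone_shrinkB.
  + move=> ? ? tau u v ltT zv uv.
    have [?|[k wk]] := zone_inflowA ltT zv uv; first by left.
    by right; exists k; rewrite /wires wk /= !roleK.
  + move=> ? ? tau u v ltT zv uv.
    have [?|[k wk]] := zone_inflowB ltT zv uv; first by left.
    by right; exists k; rewrite /wires wk /= !roleK.
- move=> x y; have [S [Sgood Sbig]] := succ_xy x y; exists S; split.
    move=> om /Sgood/correct_claims_finite ans.
    rewrite /tr /view /= view_claims //.
    by apply/idP/idP => [/ans/network_answer|/network_answer/ans].
  by rewrite -cardsT.
Qed.

End NetworkBound.

Lemma rounds_lower_bound (p' T : nat) (K : finType) (H : hierarchy p'.+2 T K)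
    (M n D B L : nat) (A : Algo n B L) (alpha : R) (pb : problem) :
    2 * T + 2 <= p'.+2 -> (top H).+1.*2 <= D ->
    4 * M.*2.+1 * p'.+2 + #|node H| + D <= n ->
    (forall (E : rel 'I_n) (s t : 'I_n),
        irreflexive E -> udiam E D -> s != t -> E s t ->
        succeeds A pb alpha E s [:: t] T) ->
  2 ^ M <= 12 * (2 ^ B).+1 ^ (T * #|K|).
Proof.
move=> cols topD fits.
(* The tail length [m] is what remains of D above the hierarchy and one site; the pads take up all
   vertices left over among the n. *)
have DE : D = (D - (top H).+1) + (top H).+1 by lia.
pose q' := (n - (4 * M.*2.+1 * p'.+2 + #|node H|)).-1.
rewrite DE; apply: (@network_bound _ _ _ _ _ _ q').
- exact: cols.
- by rewrite /q'; lia.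
- by rewrite !card_sum !card_prod !card_ord card_bool /q'; lia.
- by lia.
Qed.

(** * The two hierarchies *)

Section Hierarchies.

Variables (p' T : nat).
Let p := p'.+2.
Hypothesis enough_columns : 2 * T + 2 <= p.

Definition spine_parent (a : 'I_p) : option 'I_p :=
  if a == 0 :> nat then None else Some (inord a.-1).

Lemma spine_parentE (a a' : 'I_p) : spine_parent a = Some a' -> a = a'.+1 :> nat.
Proof.
rewrite /spine_parent; case: eqP => // a0 [<-].
by rewrite inordK; have := ltn_ord a; lia.
Qed.

Lemma spine_parent0 (a : 'I_p) : spine_parent a = None -> a = 0 :> nat.
Proof. by rewrite /spine_parent; case: eqP. Qed.

(* Adjacent columns have adjacent spine nodes, so the spine carries messages no
   faster than the tracks. *)
Definition spine : hierarchy p T void.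
Proof.
(* The root sits at column 0, so the tail belongs to zone A only. *)
refine (@Hierarchy p T void 'I_p spine_parent id (fun a => a.+1) p
  (fun tau c => c + tau + 2 <= p) (fun tau c => tau < c) true false
  (fun _ k => match k : void with end) _ _ _ _ _ _ _ _ _ _ _ _ _ _ _ _) => //.
- move=> a; case pa: (spine_parent a) => [a'|]; first by rewrite (spine_parentE pa).
  by rewrite (spine_parent0 pa).
- by move=> c c' ->; lia.
- by exists ord_max.
- by move=> tau a leT; apply/orP; lia.
- by move=> tau a ltT; lia.
- by move=> tau a ltT; lia.
- move=> tau a ltT; case pa: (spine_parent a) => [a'|] //.
  by have := spine_parentE pa; lia.
- move=> tau a ltT; case pa: (spine_parent a) => [a'|].
    by have := spine_parentE pa; lia.
  by have := spine_parent0 pa; lia.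
- by move=> tau a a' ltT /spine_parentE; left; lia.
- by move=> tau a a' ltT /spine_parentE; left; lia.
- by move=> tau a leT /spine_parent0; lia.
Defined.

Variable h : nat.
Hypothesis columns_le : p <= 2 ^ h.

Definition tree_parent (a : 'I_h.+1 * 'I_p) : option ('I_h.+1 * 'I_p) :=
  if a.1 < h then Some (inord a.1.+1, inord (a.2 %/ 2)) else None.

Lemma tree_parentE j a j' a' : tree_parent (j, a) = Some (j', a') ->
  [/\ j < h, j' = j.+1 :> nat & a' = a %/ 2 :> nat].
Proof.
rewrite /tree_parent /=; case: ifP => // jh [<- <-]; split=> //; rewrite inordK //.
by have := ltn_ord a; lia.
Qed.

Lemma tree_parent_root j a : tree_parent (j, a) = None -> j = h :> nat.
Proof. by rewrite /tree_parent /=; case: ifP => // jh _; have := ltn_ord j; lia. Qed.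

Lemma divn_exp2S c j : c %/ 2 ^ j.+1 = c %/ 2 ^ j %/ 2.
Proof. by rewrite expnSr divnMA. Qed.

Lemma divnS_le c d : c.+1 %/ d <= (c %/ d).+1.
Proof.
case: d => // d; apply: leq_trans (leq_div2r _ (_ : _ <= c + d.+1)) _; first by lia.
by rewrite divnDr // divnn addn1.
Qed.

(* Node (j, a) lies above the columns c with c %/ 2 ^ j = a.  Nodes with
   2 ^ (h - j) <= a lie above no column and belong to both zones.  At each level
   one message enters each zone, from the node next to its boundary. *)
Definition tree : hierarchy p T ('I_h.+1 * bool)%type.
Proof.
refine (@Hierarchy p T ('I_h.+1 * bool)%type ('I_h.+1 * 'I_p)%type tree_parent
  (fun c => (ord0, c)) (fun a => (h - a.1).+1) h.+1
  (fun tau a => (a.2 <= (p - 2 - tau) %/ 2 ^ a.1) || (2 ^ (h - a.1) <= a.2))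
  (fun tau a => tau.+1 %/ 2 ^ a.1 <= a.2) true true
  (fun tau k => (k.1, inord (if k.2 then ((p - 2 - tau) %/ 2 ^ k.1).+1
                             else (tau.+1 %/ 2 ^ k.1).-1)))
  _ _ _ _ _ _ _ _ _ _ _ _ _ _ _ _) => //=.
- case=> j a; case pa: (tree_parent (j, a)) => [[j' a']|] /=.
    by have [jh -> _] := tree_parentE pa; lia.
  by rewrite (tree_parent_root pa) subnn.
- by case=> j a /=; lia.
- by exists ord0; rewrite /= subn0.
- move=> tau [j a] /= leT.
  have := @divnS_le tau (2 ^ j).
  have := @leq_div2r (2 ^ j) tau (p - 2 - tau).
  by lia.
- move=> tau c leT; rewrite expn0 divn1 subn0; have := ltn_ord c; lia.
- by move=> tau c leT; rewrite expn0 divn1.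
- move=> tau [j a] /= ltT.
  have := @leq_div2r (2 ^ j) (p - 2 - tau.+1) (p - 2 - tau).
  by lia.
- move=> tau [j a] /= ltT.
  have := @leq_div2r (2 ^ j) tau.+1 tau.+2.
  by lia.
- move=> tau [j a] /= ltT; case pa: (tree_parent (j, a)) => [[j' a']|] //=.
  have [jh -> ->] := tree_parentE pa; rewrite divn_exp2S.
  have -> : h - j = (h - j.+1).+1 by lia.
  rewrite expnS.
  have := @leq_div2r (2 ^ j) (p - 2 - tau.+1) (p - 2 - tau).
  by lia.
- move=> tau [j a] /= ltT; case pa: (tree_parent (j, a)) => [[j' a']|] //=.
  have [jh -> ->] := tree_parentE pa; rewrite divn_exp2S.
  have := @leq_div2r (2 ^ j) tau.+1 tau.+2.
  by lia.
- move=> tau [j a] [j' a'] ltT pa /=.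
  have [jh -> ->] := tree_parentE pa; rewrite divn_exp2S.
  have -> : h - j = (h - j.+1).+1 by lia.
  rewrite expnS => za.
  have mono := @leq_div2r (2 ^ j) (p - 2 - tau.+1) (p - 2 - tau).
  case: (leqP a ((p - 2 - tau) %/ 2 ^ j)) => [|gt]; first by left.
  case: (leqP (2 * 2 ^ (h - j.+1)) a) => [|lt]; first by left.
  (* With boundary X = (p - 2 - tau) %/ 2 ^ j, the parent gives a %/ 2 <= X %/ 2, so a <= X + 1;
     being outside the zone, a is X + 1. *)
  right; exists (j, true) => /=; congr (_, _); apply: ord_inj.
  by rewrite inordK; have := ltn_ord a; lia.
- move=> tau [j a] [j' a'] ltT pa /=.
  have [jh -> ->] := tree_parentE pa; rewrite divn_exp2S => za.
  have step := @divnS_le tau.+1 (2 ^ j).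
  have mono := @leq_div2r (2 ^ j) tau.+1 tau.+2.
  case: (leqP (tau.+1 %/ 2 ^ j) a) => [|gt]; first by left.
  (* Symmetrically, with Y = tau.+1 %/ 2 ^ j, a < Y and Y %/ 2 <= a %/ 2 leave only a = Y - 1. *)
  right; exists (j, false) => /=; congr (_, _); apply: ord_inj.
  by rewrite inordK; have := ltn_ord a; lia.
- move=> tau [j a] leT /tree_parent_root jh _; rewrite /= jh subnn expn0; by case: (nat_of_ord a) => [|a']; rewrite ?leq0n ?orbT.
- move=> tau [j a] leT /tree_parent_root jh _; rewrite jh divn_small //=.
  by apply: leq_trans columns_le; lia.
Defined.

End Hierarchies.

(** * Parameters *)

Section Rounds.

Variables (n D b T L : nat) (A : Algo n (b * lg n) L) (alpha : R) (pb : problem).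
Hypothesis b_gt0 : 0 < b.
Hypothesis D_lb : 16 * lg n <= D.
Hypothesis D_ub : 16 * D <= n.
Hypothesis succ_A : forall (E : rel 'I_n) (s t : 'I_n),
  irreflexive E -> udiam E D -> s != t -> E s t -> succeeds A pb alpha E s [:: t] T.

(** If 16T < D, the spine network with 2T + 2 columns fits into n vertices. It has no wires, and [M]
    = 4 would give 2^4 <= 12. *)
Lemma rounds_ge_diameter : D <= 16 * T.
Proof.
rewrite leqNgt; apply/negP => ltD.
have lg0 : 0 < lg n by [].
have cols : 2 * T + 2 <= (2 * T).+2 by lia.
have := @rounds_lower_bound _ T _ (spine cols) 4 n D _ L A alpha pb cols.
rewrite card_void muln0 /= card_ord => /(_ _ _ succ_A)/=; lia.
Qed.

(** [M] is taken just large enough to contradict the communication bound, so the tree network cannot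
    fit into n vertices; its size is O(b (lg n * T)^2) + D. *)
Lemma n_le_rounds : n <= 880 * b * (lg n * T) ^ 2.
Proof.
have DT := rounds_ge_diameter.
have lg0 : 0 < lg n by [].
have T0 : 0 < T by have := D_lb; lia.
set l := lg n in lg0 *.
have lD : 16 * l <= D := D_lb.
have n_lt : n < 2 ^ l by apply: trunc_log_ltn.
pose Q := b * l * l * T.
have QE : 880 * b * (l * T) ^ 2 = 880 * (Q * T) by rewrite /Q; ring.
have bl0 : 0 < b * l by rewrite muln_gt0 b_gt0.
have TQ : T <= Q by rewrite leq_pmull // muln_gt0 bl0.
have lQ : l <= Q by rewrite /Q mulnAC leq_pmull // muln_gt0 bl0.
(* If n is smaller than the number 2T + 2 of columns, the claim is immediate; otherwise a tree of
   height lg n covers them. *)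
rewrite QE; case: (leqP (2 * T).+2 n) => [pn|]; last by nia.
have cols : 2 * T + 2 <= (2 * T).+2 by lia.
have p_le : (2 * T).+2 <= 2 ^ l by apply: leq_trans pn (ltnW n_lt).
(* [X] counts the pairs of a round and a wire. Each message takes at most 2^(B+1) values with B = b
   * l, and the summand 4 in [M] beats the factor 12. *)
pose X := T * (2 * l.+1).
pose M := 4 + (b * l).+1 * X.
have := @rounds_lower_bound _ T _ (tree cols p_le) M n D _ L A alpha pb cols.
rewrite !card_prod !card_ord card_bool /= => bound.
have [fits|overflow] := leqP (4 * M.*2.+1 * (2 * T).+2 + l.+1 * (2 * T).+2 + D) n; last first.
  have M_le : M <= 12 * Q.
    have : (b * l).+1 * X <= (2 * (b * l)) * (T * (2 * (2 * l))).
      by rewrite leq_mul ?leq_mul //; lia.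
    have -> : 2 * (b * l) * (T * (2 * (2 * l))) = 8 * Q by rewrite /Q; ring.
    by rewrite /M; lia.
  have : (4 * M.*2.+1 + l.+1) * (2 * T).+2 <= (102 * Q) * (4 * T) by apply: leq_mul; lia.
  have -> : 102 * Q * (4 * T) = 408 * (Q * T) by ring.
  (* The remaining D is at most n / 16 and is absorbed by n. *)
  have := D_ub; move: overflow; rewrite mulnDl; lia.
have topD : l.+2.*2 <= D by lia.
have := bound topD fits succ_A.
rewrite leqNgt => /negP[].
apply: (@leq_ltn_trans (12 * 2 ^ ((b * l).+1 * X))).
  rewrite leq_mul2l /= [X in _ <= X]expnM [l.+1 * 2]mulnC leq_exp2r ?muln_gt0 ?T0 //.
  by rewrite expnS mul2n -addnn -addn1 leq_add2l expn_gt0.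
by rewrite /M expnD ltn_mul2r expn_gt0.
Qed.

End Rounds.

(** * Passage to the real-valued bound *)

Section RealBound.
Local Open Scope R_scope.

Lemma le_INR_leq (i j : nat) : (i <= j)%N -> INR i <= INR j.
Proof. by move/leP; apply: le_INR. Qed.

Lemma INR_exp2 t : INR (2 ^ t)%N = 2 ^ t.
Proof. by elim: t => // t IH; rewrite expnS mult_INR IH. Qed.

(** With [t] the truncated logarithm, lg n = t + 1 <= 2t, and 2^t <= n with ln 2 > 1/2 gives t <= 2
    ln n. *)
Lemma lg_le_ln n : (1 < n)%N -> INR (lg n) <= 4 * ln (INR n).
Proof.
move=> n1; rewrite /lg; set t := trunc_log 2 n.
have t1 : 1 <= INR t by apply: (@le_INR_leq 1); rewrite trunc_log_gt0.
have tn : 2 ^ t <= INR n.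
  by rewrite -INR_exp2; apply: le_INR_leq; apply: trunc_logP; rewrite // ltnW.
have lnt : INR t * ln 2 <= ln (INR n).
  rewrite -ln_pow; last by lra.
  have pos : 0 < 2 ^ t by apply: pow_lt; lra.
  by case: tn => [lt|->]; [left; apply: ln_increasing|right].
by have := ln_lt_2; rewrite S_INR; nra.
Qed.

Lemma rounds_real_bound (b n D T : nat) : (1 < n)%N ->
    (n <= 880 * b * (lg n * T) ^ 2)%N -> (D <= 16 * T)%N ->
  / (4 * sqrt (INR (880 * b)%N) + 16) * (sqrt (INR n) / ln (INR n) + INR D) <= INR T.
Proof.
move=> n1 nT DT; set v := sqrt (INR _).
have v0 : 0 <= v := sqrt_pos _.
have T0 := pos_INR T.
have l0 := pos_INR (lg n).
have lgn := lg_le_ln n1.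
have ln_pos : 0 < ln (INR n).
  by have : 0 < INR (lg n); [apply: lt_0_INR; apply/ltP|lra].
have sqrt_le : sqrt (INR n) <= v * (INR (lg n) * INR T).
  rewrite -[INR (lg n) * INR T]sqrt_square; last by apply: Rmult_le_pos.
  rewrite -sqrt_mult_alt; last exact: pos_INR.
  by apply: sqrt_le_1_alt; rewrite -!mult_INR; apply: le_INR_leq.
have quot : sqrt (INR n) / ln (INR n) <= 4 * v * INR T.
  apply: (Rmult_le_reg_r (ln (INR n))) => //.
  rewrite /Rdiv Rmult_assoc Rinv_l; last by lra.
  have : v * INR T * INR (lg n) <= v * INR T * (4 * ln (INR n)).
    by apply: Rmult_le_compat_l => //; apply: Rmult_le_pos.
  by lra.
have D_le : INR D <= 16 * INR T.
  by have := le_INR_leq DT; rewrite mult_INR; simpl; lra.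
apply: (Rmult_le_reg_l (4 * v + 16)); first by lra.
rewrite -Rmult_assoc Rinv_r; last by lra.
by lra.
Qed.

End RealBound.

Theorem theorem3 :
  forall alpha : R, Rlt 1 alpha ->
  forall b : nat, 0 < b ->
  exists c : R, Rlt 0 c /\
  exists k n0 : nat, 0 < k /\
  forall n : nat, n0 <= n ->
  forall D : nat, k * lg n <= D <= n %/ k ->
  forall (pb : problem) (T L : nat) (A : Algo n (b * lg n) L),
    (forall (E : rel 'I_n) (s t : 'I_n),
        irreflexive E -> udiam E D -> s != t -> E s t ->
        succeeds A pb alpha E s [:: t] T) ->
    Rle (Rmult c (Rplus (Rdiv (sqrt (INR n)) (ln (INR n))) (INR D))) (INR T).
Proof.
(* The constant c stays open until [rounds_real_bound] fixes it. *)
move=> alpha _ b b0; eexists; split; last first.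
  exists 16, 2; split=> // n n2 D /andP[lD Dn] pb T L A succ_A.
  have {}Dn : 16 * D <= n by rewrite mulnC -leq_divRL.
  apply: rounds_real_bound n2 (n_le_rounds b0 lD Dn succ_A) _.
  exact: rounds_ge_diameter lD Dn succ_A.
apply: Rinv_0_lt_compat; have := sqrt_pos (INR (880 * b)); lra.
Qed.
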